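(* Let $n,p\in\mathbb{N}$, $\epsilon>0$, and $\delta=o(\frac1n)$. For every $(\epsilon,\delta)$-differentially private algorithm which takes data sets of size $n$ with entries in $\{-\frac{1}{\sqrt p},\frac{1}{\sqrt p}\}^p$ and whose output, denoted $\theta^{priv}$, lies in the Euclidean unit ball $\mathbb{B}\subset\mathbb{R}^p$, there is a data set $\mathcal{D}=\{d_1,\dots,d_n\}\subseteq\{-\frac{1}{\sqrt p},\frac{1}{\sqrt p}\}^p$ such that, with probability at least $1/3$ over the algorithm's random coins, $$\mathcal{L}(\theta^{priv};\mathcal{D})-\mathcal{L}(\theta^*;\mathcal{D})=\Omega\left(\min\left(n,\frac{\sqrt p}{\epsilon}\right)\right),$$ where $\mathcal{L}(\theta;\mathcal{D})=-\left\langle\theta,\sum_{i=1}^nd_i\right\rangle$ for $\theta\in\mathbb{B}$, and $\theta^*=\frac{\sum_{i=1}^nd_i}{\left\|\sum_{i=1}^nd_i\right\|_2}$ is the minimizer of $\mathcal{L}(\cdot;\mathcal{D})$ over $\mathbb{B}$.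
   Context: $\Omega(\cdot)$ hides an absolute positive multiplicative constant; $\delta=\delta(n)$ is a function of $n$ with $n\delta(n)\to0$. Data sets are multisets (entries may repeat). Differential privacy: two data sets of size $n$ are neighbors if they differ in one entry. A randomized algorithm $\mathcal{A}$ is $(\epsilon,\delta)$-differentially private if for all neighboring $\mathcal{D},\mathcal{D}'$ and all events $S$ in the output space, $\Pr(\mathcal{A}(\mathcal{D})\in S)\le e^{\epsilon}\Pr(\mathcal{A}(\mathcal{D}')\in S)+\delta$.
   Formalization: The formal theorem assumes ε ≤ κp for an absolute constant κ > 0, since the claim fails for large ε/p (e.g. p = 1, ε = 1, δ = 0, n even); as δ = o(1/n) is asymptotic, it is stated for all n ≥ N with N depending only on the function δ. *)

(* Defs.v *)
From HB Require Import structures.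
From mathcomp Require Import all_boot all_order all_algebra.
From mathcomp Require Import finmap multiset.
From mathcomp Require Import all_classical all_reals all_analysis.

Set Implicit Arguments.
Unset Strict Implicit.
Unset Printing Implicit Defensive.

Import Order.TTheory GRing.Theory Num.Theory.
Import numFieldNormedType.Exports.

Local Open Scope classical_set_scope.
Local Open Scope ring_scope.
Local Open Scope mset_scope.

Definition dotv (R : realType) (p : nat) (u v : 'rV[R]_p) : R :=
  \sum_(j < p) u 0 j * v 0 j.

(* The library norm [`|u|] on row vectors is the sup norm, hence this one. *)
Definition norm2 (R : realType) (p : nat) (u : 'rV[R]_p) : R :=
  Num.sqrt (dotv u u).

Definition unit_ball (R : realType) (p : nat) : set 'rV[R]_p :=
  [set theta | norm2 theta <= 1].

Definition borel_rV (R : realType) (p : nat) :=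
  g_sigma_algebraType (@open 'rV[R]_p).

Definition hypercube (R : realType) (p : nat) : set 'rV[R]_p :=
  [set d | forall j, d 0 j = - (Num.sqrt p%:R)^-1 \/ d 0 j = (Num.sqrt p%:R)^-1].

Definition dataset (R : realType) (n p : nat) : set {mset 'rV[R]_p} :=
  [set D : {mset 'rV[R]_p} | size D = n /\ forall d, d \in D -> hypercube d].

Definition neighbors (T : choiceType) (D D' : {mset T}) : Prop :=
  exists (E : {mset T}) (x y : T), [/\ x != y, D = x +` E & D' = y +` E].

(* A randomized algorithm maps a data set to the law of its output; its values
   outside [dataset n p] are irrelevant. *)
Definition algorithm (R : realType) (p : nat) :=
  {mset 'rV[R]_p} -> probability (borel_rV R p) R.

Definition diff_private (R : realType) (n p : nat) (eps delta : R)
    (A : algorithm R p) : Prop :=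
  forall D D' : {mset 'rV[R]_p}, dataset n D -> dataset n D' -> neighbors D D' ->
  forall S : set (borel_rV R p), measurable S ->
    (A D S <= (expR eps)%:E * A D' S + delta%:E)%E.

Definition output_in_ball (R : realType) (n p : nat) (A : algorithm R p) : Prop :=
  forall D : {mset 'rV[R]_p}, dataset n D -> A D (@unit_ball R p) = 1%E.

Definition data_sum (R : realType) (p : nat) (D : {mset 'rV[R]_p}) : 'rV[R]_p :=
  \sum_(d <- D) d.

Definition loss (R : realType) (p : nat) (theta : 'rV[R]_p)
    (D : {mset 'rV[R]_p}) : R :=
  - dotv theta (data_sum D).

(* Equal to 0 when the data sum vanishes; the loss is then constantly 0. *)
Definition theta_star (R : realType) (p : nat) (D : {mset 'rV[R]_p}) : 'rV[R]_p :=
  (norm2 (data_sum D))^-1 *: data_sum D.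

Section Loss.
Variables (R : realType) (p : nat).
Implicit Types (u v theta : 'rV[R]_p) (D : {mset 'rV[R]_p}).

Lemma dotv_ge0 u : 0 <= dotv u u.
Proof. by apply: sumr_ge0 => j _; rewrite -expr2 sqr_ge0. Qed.

Lemma norm2_sqr u : norm2 u ^+ 2 = dotv u u.
Proof. by rewrite sqr_sqrtr// dotv_ge0. Qed.

Lemma dotvZl a u v : dotv (a *: u) v = a * dotv u v.
Proof. by rewrite /dotv mulr_sumr; apply: eq_bigr => j _; rewrite mxE mulrA. Qed.

Lemma norm2_eq0 u : norm2 u = 0 -> u = 0.
Proof.
move=> u0; have := norm2_sqr u; rewrite u0 expr0n /= => /esym u00.
have u2 : forall j, true -> 0 <= u 0 j * u 0 j by move=> j _; rewrite -expr2 sqr_ge0.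
apply/rowP => j; have /eqP := psumr_eq0P u2 u00 (i := j) isT.
by rewrite mulf_eq0 orbb mxE => /eqP.
Qed.

Lemma loss_theta_star D : loss (theta_star D) D = - norm2 (data_sum D).
Proof.
rewrite /loss /theta_star dotvZl -norm2_sqr.
have [->|s0] := eqVneq (norm2 (data_sum D)) 0; first by rewrite expr0n /= mulr0.
by rewrite expr2 mulrA mulVf// mul1r.
Qed.

Lemma theta_star_ball D : unit_ball (theta_star D).
Proof.
have N0 : 0 <= norm2 (data_sum D) by exact: sqrtr_ge0.
rewrite /unit_ball /= -(@expr_le1 _ 2)// ?sqrtr_ge0// norm2_sqr /theta_star.
have -> : forall a u, dotv (a *: u) (a *: u) = a ^+ 2 * dotv u u.
  by move=> a u; rewrite /dotv mulr_sumr; apply: eq_bigr => j _;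
    rewrite !mxE mulrACA.
rewrite -norm2_sqr -exprMn.
have [->|s0] := eqVneq (norm2 (data_sum D)) 0; first by rewrite mulr0 expr0n ler01.
by rewrite mulVf// expr1n.
Qed.

Lemma theta_star_minimizes D theta : unit_ball theta ->
  loss (theta_star D) D <= loss theta D.
Proof.
rewrite /unit_ball /= => th1; rewrite loss_theta_star lerN2.
set s := data_sum D; set N := norm2 s.
have [/norm2_eq0 s0|N0] := eqVneq N 0.
  by rewrite /N s0 /dotv big1 ?sqrtr_ge0// => j _; rewrite mxE mulr0.
have Np : 0 < N by rewrite lt_def N0 sqrtr_ge0.
have th2 : dotv theta theta <= 1.
  by rewrite -norm2_sqr expr_le1// sqrtr_ge0.
have : 0 <= \sum_(j < p) (N * theta 0 j - s 0 j) ^+ 2.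
  by apply: sumr_ge0 => j _; exact: sqr_ge0.
have -> : \sum_(j < p) (N * theta 0 j - s 0 j) ^+ 2 =
    N ^+ 2 * dotv theta theta - (N * dotv theta s) *+ 2 + dotv s s.
  rewrite /dotv !mulr_sumr -sumrMnl -sumrB -big_split /=.
  by apply: eq_bigr => j _; rewrite sqrrB exprMn -!expr2 mulrA.
rewrite -(norm2_sqr s) -/N => H.
have H1 : N ^+ 2 * dotv theta theta <= N ^+ 2 by rewrite ler_piMr ?sqr_ge0.
rewrite -(ler_pM2l Np) -expr2 -(@ler_pMn2r _ 2)//.
rewrite -subr_ge0 mulr2n; apply: (le_trans H).
by rewrite addrAC lerD2r lerD2r.
Qed.

Lemma continuous_dotv (f g : 'rV[R]_p -> 'rV[R]_p) :
  continuous f -> continuous g -> continuous (fun x => dotv (f x) (g x) : R).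
Proof.
move=> cf cg; apply: continuous_big => [|j _ x]; first exact: add_continuous.
apply: cvgM; first exact: (@nbhs_filter _ x).
  exact: (cvg_comp f (fun M : 'rV[R]_p => M 0 j) (cf x) (@coord_continuous _ _ _ 0 j _)).
exact: (cvg_comp g (fun M : 'rV[R]_p => M 0 j) (cg x) (@coord_continuous _ _ _ 0 j _)).
Qed.

Lemma measurable_closed_rV (S : set (borel_rV R p)) :
  closed (S : set 'rV[R]_p) -> measurable S.
Proof.
move=> cS; rewrite -(setCK S); apply: measurableC.
by apply: sub_sigma_algebra; exact: closed_openC.
Qed.

Lemma measurable_unit_ball : measurable (unit_ball (R:=R) (p:=p) : set (borel_rV R p)).
Proof.
apply: measurable_closed_rV.
have -> : @unit_ball R p = (fun u => dotv u u) @^-1` [set x | x <= 1].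
  apply/seteqP; split => u /=; rewrite /unit_ball /= -norm2_sqr.
    by move=> u1; rewrite expr_le1// sqrtr_ge0.
  by rewrite expr_le1// sqrtr_ge0.
by apply: preimage_closed; [move=> x _; apply: continuous_dotv => y; exact: cvg_id
  |exact: closed_le].
Qed.

Lemma measurable_excess D (t : R) :
  measurable ([set theta | t <= loss theta D - loss (theta_star D) D]
    : set (borel_rV R p)).
Proof.
apply: measurable_closed_rV.
apply: (@preimage_closed _ _
  (fun theta => loss theta D - loss (theta_star D) D : R) [set x | t <= x]);
  last exact: closed_ge.
move=> x _; apply: (@cvgB R R^o _ _ (@nbhs_filter _ x)); last exact: cvg_cst.
apply: (@cvgN R R^o _ _ (@nbhs_filter _ x)).
by apply: (@continuous_dotv id (cst (data_sum D))) => y;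
  [exact: cvg_id|exact: cst_continuous].
Qed.

End Loss.

(* Main.v *)
(* Fix i.i.d. uniformly random column means in [-1, 1] and, given these, m + 1
   independent sign vectors; run the algorithm on the m rows other than row b (padded
   with opposite pairs, which do not contribute to the data sum).  Given the other m
   rows, the coordinates of a row are independent, and by Laplace's rule their means
   are the column sums divided by m + 2.  Let the score of row a be the inner product
   of the output with (row a - this conditional mean).
   If row a was not part of the input, its score is centered and subgaussian.  By
   privacy this remains nearly so if row a was part of the input: the expected score
   is then O(eps) for eps <= 1, O(sqrt eps) for eps >= 1, plus O(delta * sqrt p).
   On the other hand the scores of the m input rows add up, in expectation, to about
   2 / m times the inner product of the output with the column sums, whose norm is of
   order m * sqrt p.  If on every data set the excess loss were below c * m with
   probability more than 2/3, the total score would thus be at least a constant times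
   sqrt p, which fails for m about c0 * min(n, sqrt p / eps).
   The mean is never sampled: integrating it out gives a Polya urn, so that the prior
   is a finite sum. *)

Require Import Defs.
From HB Require Import structures.
From mathcomp Require Import all_boot all_order all_algebra.
From mathcomp Require Import finmap multiset.
From mathcomp Require Import all_classical all_reals all_analysis.
From mathcomp Require Import measurable_realfun zify ring lra.

Import Order.TTheory GRing.Theory Num.Theory.
Import numFieldNormedType.Exports.

Local Open Scope classical_set_scope.
Local Open Scope ring_scope.
Local Open Scope mset_scope.

Set Implicit Arguments.
Unset Strict Implicit.
Unset Printing Implicit Defensive.

(** * Integration of bounded functions, and privacy for expectations *)

Section Integration.
Context d (T : measurableType d) (R : realType) (D : set T).
Hypothesis mD : measurable D.

Definition bounded_measurable (f : T -> R) :=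
  measurable_fun D f /\ exists B, forall x, D x -> `|f x| <= B.

Lemma bm_integrable (P : probability T R) f :
  bounded_measurable f -> P.-integrable D (EFin \o f).
Proof.
move=> [mf [B fB]]; apply: measurable_bounded_integrable => //.
- by apply: (le_lt_trans (probability_le1 P mD)); rewrite ltry.
- exists B; split; first by rewrite num_real.
  by move=> y By x Dx /=; apply: (le_trans (fB x Dx)); exact: ltW.
Qed.

Lemma bm_cst c : bounded_measurable (fun=> c).
Proof. by split => //; exists `|c|. Qed.

Lemma bmD f g : bounded_measurable f -> bounded_measurable g ->
  bounded_measurable (fun x => f x + g x).
Proof.
move=> [mf [B fB]] [mg [C gC]]; split; first exact: measurable_funD.
by exists (B + C) => x Dx; apply: (le_trans (ler_normD _ _)); rewrite lerD ?fB ?gC.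
Qed.

Lemma bmM f g : bounded_measurable f -> bounded_measurable g ->
  bounded_measurable (fun x => f x * g x).
Proof.
move=> [mf [B fB]] [mg [C gC]]; split; first exact: measurable_funM.
by exists (B * C) => x Dx; rewrite normrM ler_pM ?fB ?gC.
Qed.

Lemma bmZ c f : bounded_measurable f -> bounded_measurable (fun x => c * f x).
Proof. by move=> bf; apply: bmM => //; exact: bm_cst. Qed.

Lemma bm_sum (I : Type) (s : seq I) (Q : pred I) (f : I -> T -> R) :
  (forall i, Q i -> bounded_measurable (f i)) ->
  bounded_measurable (fun x => \sum_(i <- s | Q i) f i x).
Proof.
move=> bf; elim: s => [|i s IH].
  rewrite [X in bounded_measurable X](_ : _ = fun=> 0); first exact: bm_cst.
  by apply/funext => x; rewrite big_nil.
rewrite [X in bounded_measurable X](_ : _ = fun x =>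
    (if Q i then f i x else 0) + \sum_(i <- s | Q i) f i x).
  by apply: bmD => //; case Qi: (Q i); [exact: bf|exact: bm_cst].
by apply/funext => x; rewrite big_cons; case: ifP; rewrite ?add0r.
Qed.

Lemma bm_exp f : bounded_measurable f -> bounded_measurable (fun x => expR (f x)).
Proof.
move=> [mf [B fB]]; split; first by apply: measurableT_comp => //; exact: measurable_expR.
exists (expR B) => x Dx; rewrite ger0_norm ?expR_ge0// ler_expR.
by apply: le_trans (fB x Dx); exact: ler_norm.
Qed.

Lemma bm_max f g : bounded_measurable f -> bounded_measurable g ->
  bounded_measurable (fun x => Num.max (f x) (g x)).
Proof.
move=> [mf [B fB]] [mg [C gC]]; split; first exact: measurable_maxr.
exists (B + C) => x Dx; have := fB x Dx; have := gC x Dx.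
have := normr_ge0 (f x); have := normr_ge0 (g x).
by case: (leP (f x) (g x)) => _; lra.
Qed.

Lemma bm_indic (A : set T) : measurable A -> bounded_measurable (\1_A : T -> R).
Proof.
move=> mA; split; first by apply: measurable_indic.
by exists 1 => x _; rewrite indicE; case: (_ \in _); rewrite ?normr1 ?normr0.
Qed.

Section Expectation.
Variable P : probability T R.
Hypothesis PD : P D = 1%E.

Lemma Rint_cst c : \int[P]_(x in D) c = c.
Proof.
rewrite Rintegral_cst// (_ : fine _ = 1) ?mulr1//.
exact: (congr1 fine PD).
Qed.

Lemma RintD f g : bounded_measurable f -> bounded_measurable g ->
  \int[P]_(x in D) (f x + g x) = \int[P]_(x in D) f x + \int[P]_(x in D) g x.
Proof. by move=> bf bg; rewrite RintegralD//; exact: bm_integrable. Qed.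

Lemma RintZ c f : bounded_measurable f ->
  \int[P]_(x in D) (c * f x) = c * \int[P]_(x in D) f x.
Proof. by move=> bf; rewrite RintegralZl//; exact: bm_integrable. Qed.

Lemma Rint_sum (I : Type) (s : seq I) (Q : pred I) (f : I -> T -> R) :
  (forall i, Q i -> bounded_measurable (f i)) ->
  \int[P]_(x in D) (\sum_(i <- s | Q i) f i x) =
  \sum_(i <- s | Q i) \int[P]_(x in D) f i x.
Proof.
move=> bf; elim: s => [|i s IH].
  by under eq_Rintegral do rewrite big_nil; rewrite Rint_cst big_nil.
under eq_Rintegral do rewrite big_cons; rewrite big_cons; case: ifP => [Qi|_//].
by rewrite RintD ?IH//; [exact: bf|exact: bm_sum].
Qed.

Lemma le_Rint f g : bounded_measurable f -> bounded_measurable g ->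
  (forall x, D x -> f x <= g x) ->
  \int[P]_(x in D) f x <= \int[P]_(x in D) g x.
Proof. by move=> bf bg fg; apply: le_Rintegral => //; exact: bm_integrable. Qed.

Lemma Rint_indic (A : set T) : measurable A ->
  \int[P]_(x in D) \1_A x = fine (P (A `&` D)%classic).
Proof. by move=> mA; rewrite /Rintegral integral_indic. Qed.

End Expectation.

Let expectation_restrict (P : probability T R) (f : T -> R) :
  ('E_P[f \_ D] = \int[P]_(x in D) (f x)%:E)%E.
Proof. by rewrite unlock [RHS]integral_mkcond restrict_EFin. Qed.

(** Layer-cake formula: the mean of a nonnegative variable is the integral of its tail
    probabilities, and privacy applies to each tail event. Tails above level [B] are empty, so
    [delta] is paid only on an interval of length [B]. *)
Lemma le_integral_dp (P Q : probability T R) (eps delta B : R) (f : T -> R) :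
  0 <= delta ->
  (forall S, measurable S -> P S <= (expR eps)%:E * Q S + delta%:E)%E ->
  measurable_fun D f -> (forall x, D x -> 0 <= f x <= B) -> 0 <= B ->
  \int[P]_(x in D) f x <= expR eps * \int[Q]_(x in D) f x + delta * B.
Proof.
move=> d0 dp mf f0B B0.
have bf : bounded_measurable f.
  split => //; exists B => x Dx; have /andP[? ?] := f0B x Dx.
  by rewrite ger0_norm.
have mg : measurable_fun [set: T] (f \_ D) by exact/(measurable_restrictT _ mD).
(* Extension by zero outside [D] makes [f] a random variable on the whole space. *)
pose X : {mfun T >-> R} := HB.pack (f \_ D) (isMeasurableFun.Build _ _ _ _ _ mg).
have X0 x : 0 <= X x.
  by rewrite /= patchE; case: ifPn => // /set_mem /f0B /andP[].
have XB x : X x <= B.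
  by rewrite /= patchE; case: ifPn => // /set_mem /f0B /andP[].
have key : ('E_P[X] <= (expR eps)%:E * 'E_Q[X] + (delta * B)%:E)%E.
  rewrite !ge0_expectation_ccdf//.
  have ccdf0 (M : probability T R) r : (0 <= ccdf (X : {RV M >-> R}) r)%E.
    exact: measure_ge0.
  rewrite -ge0_integralZl//; last by apply: measurable_funTS; exact: ccdf_measurable.
  pose h (r : R) := (delta * \1_(`[0, B[%classic : set R) r)%:E.
  have mh A : measurable_fun A h.
    apply/measurable_EFinP; apply: measurable_funM; first exact: measurable_cst.
    by apply: (@measurable_indic _ (measurableTypeR R)); exact: measurable_itv.
  have -> : (delta * B)%:E = (\int[lebesgue_measure]_(r in `[0%R, +oo[) h r)%E.
    rewrite /h; under eq_integral do rewrite EFinM.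
    rewrite ge0_integralZl//; first last.
    - apply/measurable_EFinP; apply: (@measurable_indic _ (measurableTypeR R)).
      exact: measurable_itv.
    rewrite integral_indic//.
    rewrite (_ : (_ `&` _)%classic = `[0, B[%classic); last first.
      by apply/setIidPl => x /=; rewrite !in_itv/= => /andP[-> _].
    rewrite EFinM; congr (_ * _)%E.
    apply/esym/(etrans (lebesgue_measure_itv `[0, B[)); rewrite /= lte_fin.
    by case: ltP => [_|B0']; rewrite ?sube0//; congr EFin; apply/esym/le_anti/andP.
  rewrite -ge0_integralD//; last 4 first.
  - by move=> r _; rewrite mule_ge0// lee_fin expR_ge0.
  - by apply: measurable_funeM; apply: measurable_funTS; exact: ccdf_measurable.
  - by move=> r _; rewrite lee_fin mulr_ge0// indicE.
  - exact: mh.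
  apply: ge0_le_integral => //.
  - by apply: measurable_funTS; exact: ccdf_measurable.
  - apply: emeasurable_funD; last exact: mh.
    by apply: measurable_funeM; apply: measurable_funTS; exact: ccdf_measurable.
  move=> r; rewrite /= in_itv/= andbT => r0.
  have [rB|Br] := ltP r B.
    have -> : h r = delta%:E by rewrite /h indicE mem_set ?mulr1//= in_itv/= r0.
    by apply: dp; exact: measurable_funPTI.
  have -> : ccdf (X : {RV P >-> R}) r = 0%E.
    rewrite /ccdf /distribution /pushforward (_ : _ @^-1` _ = set0) ?measure0//.
    by apply/seteqP; split => // x; rewrite /preimage/= in_itv/= andbT ltNge (le_trans (XB x)).
  rewrite adde_ge0// ?mule_ge0 ?lee_fin ?expR_ge0//.
  by rewrite mulr_ge0// indicE.
move: key; rewrite !expectation_restrict.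
have fin (M : probability T R) :
    (\int[M]_(x in D) (f x)%:E)%E = (\int[M]_(x in D) f x)%:E.
  rewrite /Rintegral fineK//; apply: integrable_fin_num => //.
  exact: bm_integrable.
by rewrite !fin -EFinM -EFinD lee_fin.
Qed.

End Integration.

(** * Hoeffding's bound for finite product weights *)

Lemma expR_le_quadratic (R : realType) (x : R) : x <= 1 ->
  expR x <= 1 + x + 2 * x ^+ 2.
Proof.
(* Squaring 1 - x/2 <= exp(-x/2) bounds exp(x) by the inverse of (1 - x/2)^2; it remains to see that
   the quadratic dominates this inverse. *)
move=> x1; have y0 : 0 < 1 - x / 2 by lra.
have e1 : 1 - x / 2 <= expR (- (x / 2)) by exact: expR_ge1Dx.
have := ler_pM (ltW y0) (ltW y0) e1 e1.
rewrite -expRD (_ : - (x / 2) + - (x / 2) = - x); last by field.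
rewrite expRN => H.
have : expR x * ((1 - x / 2) * (1 - x / 2)) <= 1.
  by rewrite -ler_pdivlMl ?expR_gt0// mulr1.
have h2 : 1 <= (1 + x + 2 * x ^+ 2) * ((1 - x / 2) * (1 - x / 2)).
  rewrite -subr_ge0 (_ : _ - 1 = x ^+ 2 * ((1 - x) * (5 - 2 * x)) / 4); last by field.
  by rewrite divr_ge0// mulr_ge0 ?sqr_ge0// mulr_ge0; lra.
by move=> /le_trans/(_ h2); rewrite ler_pM2r// mulr_gt0.
Qed.

(** The linear term averages out for a centered variable, leaving a subgaussian bound with no
    first-order loss. Beyond [x = 1] the square alone dominates. *)
Lemma expR_le_add_expR_sqr (R : realType) (x : R) : expR x <= x + expR (2 * x ^+ 2).
Proof.
have [x1|x1] := leP x 1.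
  by have := expR_le_quadratic x1; have := expR_ge1Dx (2 * x ^+ 2); lra.
have h : expR x <= expR (2 * x ^+ 2).
  rewrite ler_expR expr2; apply: (@le_trans _ _ (x * x)).
    by rewrite ler_peMl; lra.
  by rewrite ler_peMl ?mulr_ge0; lra.
lra.
Qed.

Section ProductWeights.
Variables (R : realType) (I J : finType).
Implicit Types (q v : I -> J -> R).

Lemma sum_prod_centered q v : (forall i, \sum_b q i b * v i b = 0) ->
  \sum_(f : {ffun I -> J}) (\prod_i q i (f i)) * (\sum_i v i (f i)) = 0.
Proof.
move=> qv0; under eq_bigr do rewrite mulr_sumr.
rewrite exchange_big big1//= => i _.
(* With [v] absorbed into the factor [i], the sum over functions becomes a product of sums, whose
   factor [i] vanishes. *)
pose F k b := q k b * (if k == i then v k b else 1).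
rewrite (eq_bigr (fun f : {ffun I -> J} => \prod_k F k (f k))).
  rewrite -(bigA_distr_bigA F) (bigD1 i)//= /F eqxx.
  by rewrite qv0 mul0r.
move=> f _; rewrite /F big_split/=; congr (_ * _).
by rewrite (bigD1 i)//= eqxx big1 ?mulr1// => k /negbTE ->.
Qed.

(* Hoeffding: each factor satisfies [E e^v <= E v + E e^(2v^2)], and [E v = 0]. *)
Lemma sum_prod_expR q v (c : I -> R) : (forall i b, 0 <= q i b) ->
  (forall i, \sum_b q i b * v i b = 0) -> (forall i b, v i b ^+ 2 <= c i) ->
  \sum_(f : {ffun I -> J}) (\prod_i q i (f i)) * expR (\sum_i v i (f i)) <=
  expR (2 * \sum_i c i) * \sum_(f : {ffun I -> J}) \prod_i q i (f i).
Proof.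
move=> q0 qv0 vc.
rewrite -(bigA_distr_bigA q) mulr_sumr expR_sum -big_split/=.
rewrite (eq_bigr (fun f : {ffun I -> J} => \prod_i (q i (f i) * expR (v i (f i))))); last first.
  by move=> f _; rewrite big_split/= expR_sum.
rewrite -(bigA_distr_bigA (fun i b => q i b * expR (v i b))).
apply: ler_prod => i _; rewrite sumr_ge0/=; last first.
  by move=> b _; rewrite mulr_ge0 ?expR_ge0.
apply: (@le_trans _ _ (\sum_b (q i b * v i b + q i b * expR (2 * c i)))).
  apply: ler_sum => b _; rewrite -mulrDr ler_wpM2l//.
  apply: (le_trans (expR_le_add_expR_sqr _)).
  by rewrite lerD2l ler_expR ler_wpM2l.
by rewrite big_split/= qv0 add0r -mulr_suml mulrC.
Qed.

End ProductWeights.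

Section Resampling.
Variables (R : realType) (I Y : finType).
Implicit Types (X : {ffun I -> Y}) (a : I) (y : Y).

Definition upd X a y : {ffun I -> Y} := [ffun i => if i == a then y else X i].

(** Swapping the value at [a] with the spare value [y] is an involution on pairs; after it the
    summand no longer involves the spare value. *)
Lemma sum_resample (F : {ffun I -> Y} -> R) a :
  \sum_X \sum_y F (upd X a y) = #|Y|%:R * \sum_X F X.
Proof.
rewrite pair_big/=.
pose h (Z : {ffun I -> Y} * Y) := (upd Z.1 a Z.2, Z.1 a).
have hK : involutive h.
  move=> [X y]; rewrite /h /=; congr (_, _); last by rewrite ffunE eqxx.
  by apply/ffunP => i; rewrite !ffunE; case: eqP => // ->.
rewrite (reindex_inj (inv_inj hK))/=.
rewrite (eq_bigr (fun Z => F Z.1)); last first.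
  by move=> Z _; rewrite -[in RHS](hK Z).
rewrite -(pair_big xpredT xpredT (fun X _ => F X))/= mulr_sumr.
by apply: eq_bigr => X _; rewrite sumr_const mulr_natl.
Qed.

End Resampling.

(** * The Polya urn prior and its conditional means *)

Section Urn.
Variables (R : realType) (m p : nat).
Local Notation row := {ffun 'I_p -> bool}.
Local Notation conf := {ffun 'I_m.+1 -> row}.
Implicit Types (X : conf) (a b : 'I_m.+1) (j : 'I_p) (y : row) (s : bool).

Definition sg (s : bool) : R := if s then 1 else -1.

(* Up to normalisation, the law of [m.+1] draws from a Polya urn, i.e. of i.i.d.
   signs with a uniformly random mean, independently for each of the [p] columns. *)
Definition urn (k : nat) : R := (k`! * (m.+1 - k)`!)%:R.
Definition weight X : R := \prod_j urn (\sum_i X i j).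

(* By Laplace's rule of succession, the conditional mean of [sg (X a j)] given the
   other rows. *)
Definition cmean X a j : R := (\sum_(l | l != a) sg (X l j)) / m.+2%:R.

Definition score X a (theta : 'rV[R]_p) : R :=
  \sum_j theta 0 j * (sg (X a j) - cmean X a j).

Lemma sgE s : sg s = 2 * s%:R - 1.
Proof. by case: s; rewrite /sg /=; ring. Qed.

Lemma sg_norm s : `|sg s| = 1.
Proof. by case: s; rewrite /sg ?normrN normr1. Qed.

Lemma sg_sqr s : sg s * sg s = 1.
Proof. by case: s; rewrite /sg ?mulrNN mulr1. Qed.

Lemma urn_gt0 k : 0 < urn k.
Proof. by rewrite ltr0n muln_gt0 !fact_gt0. Qed.

Lemma weight_gt0 X : 0 < weight X.
Proof. by apply: prodr_gt0 => j _; exact: urn_gt0. Qed.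

Lemma total_weight_gt0 : 0 < \sum_X weight X.
Proof.
rewrite (bigD1 [ffun=> [ffun=> true]])//= ltr_pwDl ?weight_gt0//.
by apply: sumr_ge0 => X _; exact/ltW/weight_gt0.
Qed.

Lemma cmean_upd X a y j : cmean (upd X a y) a j = cmean X a j.
Proof.
by congr (_ / _); apply: eq_bigr => l /negbTE la; rewrite ffunE la.
Qed.

Lemma card_others a : #|[pred l : 'I_m.+1 | l != a]| = m.
Proof. by have := cardC1 a; rewrite card_ord. Qed.

Lemma cmean_norm X a j : `|cmean X a j| <= 1.
Proof.
rewrite normrM normfV normr_nat ler_pdivrMr ?ltr0n// mul1r.
apply: (le_trans (ler_norm_sum _ _ _)).
under eq_bigr do rewrite sg_norm.
by rewrite sumr_const card_others ler_nat leqW.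
Qed.

Lemma score_coef_norm X a j : `|sg (X a j) - cmean X a j| <= 2.
Proof.
apply: (le_trans (ler_normB _ _)).
by rewrite sg_norm; have := cmean_norm X a j; lra.
Qed.

(** Unnormalised conditional law of the entry [(a, j)] given the other rows. *)
Let q X a j (s : bool) : R := urn (\sum_(l | l != a) X l j + s).

Lemma weight_upd X a y : weight (upd X a y) = \prod_j q X a j (y j).
Proof.
apply: eq_bigr => j _; rewrite /q; congr urn.
rewrite (bigD1 a)//= addnC ffunE eqxx; congr (_ + _)%N.
by apply: eq_bigr => l /negbTE la; rewrite ffunE la.
Qed.

(** With k plus signs and r minus signs in the other rows, the weights of plus and minus are (k+1)!
    r! and k! (r+1)!. Their ratio is (k+1) : (r+1), so the mean sign is (k - r) / (k + r + 2). *)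
Lemma urn_centered X a j : \sum_s q X a j s * (sg s - cmean X a j) = 0.
Proof.
rewrite big_bool /= /q /cmean.
set k := (\sum_(l | l != a) X l j)%N.
have km : (k <= m)%N.
  rewrite -[X in (_ <= X)%N](card_others a) -sum1_card.
  by apply: leq_sum => l _; case: (X l j).
have -> : \sum_(l | l != a) sg (X l j) = 2 * k%:R - m%:R.
  under eq_bigr do rewrite sgE.
  by rewrite sumrB -mulr_sumr natr_sum sumr_const card_others.
rewrite /urn addn1 addn0 subSS subSn// !factS /sg.
have [r ->] : exists r, m = (k + r)%N by exists (m - k)%N; rewrite subnKC.
rewrite addKn !natrM -!natr1 !natrD.
field; apply: lt0r_neq0; have := ler0n R k; have := ler0n R r; lra.
Qed.

Lemma sum_weight_score X a (theta : 'rV[R]_p) :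
  \sum_y weight (upd X a y) * score (upd X a y) a theta = 0.
Proof.
rewrite (eq_bigr (fun y : row => (\prod_j q X a j (y j)) *
    \sum_j theta 0 j * (sg (y j) - cmean X a j))); last first.
  move=> y _; rewrite weight_upd; congr (_ * _); apply: eq_bigr => j _.
  by rewrite cmean_upd ffunE eqxx.
apply: (sum_prod_centered (v := fun j s => theta 0 j * (sg s - cmean X a j))) => j.
under eq_bigr do rewrite mulrCA.
by rewrite -mulr_sumr urn_centered mulr0.
Qed.

(** Given the other rows, the coordinates are independent, centered and at most 2 in size.
    Hoeffding's bound with constants 4 [lam]^2 [theta]_j^2, which sum to at most 4 [lam]^2 on the
    ball, gives the exponent. *)
Lemma sum_weight_exp_score X a (theta : 'rV[R]_p) (lam : R) : unit_ball theta ->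
  \sum_y weight (upd X a y) * expR (lam * score (upd X a y) a theta) <=
  expR (8 * lam ^+ 2) * \sum_y weight (upd X a y).
Proof.
move=> th1.
have -> : \sum_y weight (upd X a y) = \sum_(y : row) \prod_j q X a j (y j).
  by apply: eq_bigr => y _; exact: weight_upd.
rewrite (eq_bigr (fun y : row => (\prod_j q X a j (y j)) *
    expR (\sum_j lam * (theta 0 j * (sg (y j) - cmean X a j))))); last first.
  move=> y _; rewrite weight_upd -mulr_sumr; congr (_ * expR (_ * _)).
  by apply: eq_bigr => j _; rewrite cmean_upd ffunE eqxx.
have vv s j : (sg s - cmean X a j) ^+ 2 <= 4.
  rewrite (_ : 4 = 2 ^+ 2); last by ring.
  have h : `|sg s - cmean X a j| <= 2.
    have := cmean_norm X a j; have := ler_normB (sg s) (cmean X a j).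
    by rewrite sg_norm; lra.
  by rewrite -real_normK ?num_real// ler_pXn2r// nnegrE.
apply: (le_trans (sum_prod_expR
    (v := fun j s => lam * (theta 0 j * (sg s - cmean X a j)))
    (c := fun j => 4 * (lam ^+ 2 * (theta 0 j * theta 0 j))) _ _ _)).
- by move=> j s; exact/ltW/urn_gt0.
- move=> j; rewrite (eq_bigr (fun s => lam * theta 0 j * (q X a j s * (sg s - cmean X a j)))).
    by rewrite -mulr_sumr urn_centered mulr0.
  by move=> s _; ring.
- move=> j s; rewrite (_ : _ ^+ 2 =
      (sg s - cmean X a j) ^+ 2 * (lam ^+ 2 * (theta 0 j * theta 0 j))); last by ring.
  by rewrite ler_wpM2r// mulr_ge0 ?sqr_ge0// -expr2 sqr_ge0.
- rewrite ler_wpM2r//.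
    by apply: sumr_ge0 => y _; apply: prodr_ge0 => j _; exact/ltW/urn_gt0.
  rewrite ler_expR -!mulr_sumr -/(dotv theta theta).
  have : dotv theta theta <= 1 by rewrite -norm2_sqr expr_le1// sqrtr_ge0.
  have := sqr_ge0 lam; nra.
Qed.

Let corr a b j := \sum_X weight X * (sg (X a j) * sg (X b j)).

Let corr_diag a j : corr a a j = \sum_X weight X.
Proof. by apply: eq_bigr => X _; rewrite sg_sqr mulr1. Qed.

(** Replacing the entry of row [a] by its conditional mean expresses [m.+2%:R * corr a b j] as the
    sum over the rows other than [a]; the term of [a] itself turns [m.+2] into [m.+3]. *)
Let corr_row a b j : a != b -> m.+3%:R * corr a b j = \sum_l corr l b j.
Proof.
move=> ab.
have h : \sum_X weight X * ((sg (X a j) - cmean X a j) * sg (X b j)) = 0.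
  apply/eqP; rewrite -(@mulrI_eq0 _ #|{: row}|%:R); last first.
    by apply/lregP; rewrite pnatr_eq0 -lt0n; apply/card_gt0P; exists [ffun=> true].
  rewrite -(sum_resample _ a) big1// => X _.
  (* At the basis vector [delta_mx 0 j] the score is the deviation of the single entry [(a, j)]. *)
  rewrite (eq_bigr (fun y : row => sg (X b j) * (weight (upd X a y) *
      score (upd X a y) a (delta_mx 0 j)))); last first.
    move=> y _; have -> : upd X a y b = X b by rewrite ffunE eq_sym (negbTE ab).
    rewrite /score (bigD1 j)//= mxE !eqxx mul1r big1 ?addr0 => [|k kj]; first by ring.
    by rewrite mxE (negbTE kj) andbF mul0r.
  by rewrite -mulr_sumr sum_weight_score mulr0.
have -> : \sum_l corr l b j = corr a b j + \sum_(l | l != a) corr l b j.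
  by rewrite (bigD1 a).
suff -> : \sum_(l | l != a) corr l b j = m.+2%:R * corr a b j.
  by rewrite -[m.+3%:R]nat1r; ring.
have {}h : corr a b j = \sum_X weight X * (cmean X a j * sg (X b j)).
  apply: subr0_eq; rewrite -[RHS]h /corr -sumrB; apply: eq_bigr => X _; ring.
rewrite h /corr exchange_big/= mulr_sumr; apply: eq_bigr => X _.
rewrite -mulr_sumr -mulr_suml /cmean.
field; apply: lt0r_neq0; have := ler0n R m; lra.
Qed.

(** The constant 1/3 is the second moment of a uniform mean in [-1, 1]. It comes out of a linear
    equation: by [corr_row] all off-diagonal correlations with [b] equal C / (m + 3), where C is
    their sum including the diagonal term, so C = W + m C / (m + 3) with W the total weight. *)
Lemma sum_weight_sg_sg a b j : a != b ->
  \sum_X weight X * (sg (X a j) * sg (X b j)) = 3^-1 * \sum_X weight X.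
Proof.
move=> ab; have m3 : m.+3%:R != 0 :> R by rewrite pnatr_eq0.
have h : \sum_l corr l b j = \sum_X weight X + m%:R * ((\sum_l corr l b j) / m.+3%:R).
  rewrite {1}(bigD1 b)//= corr_diag; congr (_ + _).
  rewrite (eq_bigr (fun=> (\sum_l corr l b j) / m.+3%:R)).
    by rewrite sumr_const card_others mulr_natl.
  by move=> l lb; apply: (canRL (mulfK m3)); rewrite mulrC; exact: corr_row.
have := corr_row j ab; rewrite -/(corr a b j); set C := \sum_l _ in h *.
move=> e; move: h; rewrite -e [_ * corr a b j]mulrC mulfK// -/(corr a b j).
rewrite -{1}[m.+3]/(3 + m)%N natrD; lra.
Qed.

End Urn.

(** * Padded data sets built from sign rows *)

Section Datasets.
Variables (R : realType) (m p r : nat).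
Local Notation row := {ffun 'I_p -> bool}.
Local Notation conf := {ffun 'I_m.+1 -> row}.
Implicit Types (X : conf) (a b : 'I_m.+1) (j : 'I_p) (y : row).

Definition sign_row y : 'rV[R]_p := \row_j (sg R (y j) * (Num.sqrt p%:R)^-1).

Definition padding : seq 'rV[R]_p :=
  nseq r (sign_row [ffun=> true]) ++ nseq r (- sign_row [ffun=> true]).

(** A general [P] is allowed so that both the inputs, which omit one row, and the common part of two
    such inputs, which omits two, have this form. *)
Definition rows X (P : pred 'I_m.+1) : {mset 'rV[R]_p} :=
  seq_mset ([seq sign_row (X l) | l <- enum 'I_m.+1 & P l] ++ padding).

Definition colsum X b j : R := \sum_(l | l != b) sg R (X l j).

Lemma sign_row_hypercube y : hypercube (sign_row y).
Proof.
by move=> j; rewrite mxE /sg; case: (y j); [right; rewrite mul1r|left; rewrite mulN1r].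
Qed.

Lemma rows_size X P : size (rows X P) = (#|P| + 2 * r)%N.
Proof.
rewrite (perm_size (perm_eq_seq_mset _)) size_cat size_map size_cat !size_nseq.
by rewrite -sum1_size big_filter big_enum_cond/= sum1_card addnn mul2n.
Qed.

Lemma rows_dataset X b : dataset (m + 2 * r) (rows X (predC1 b)).
Proof.
split; first by rewrite rows_size cardC1 card_ord.
move=> d; rewrite (perm_mem (perm_eq_seq_mset _)) mem_cat => /orP[/mapP[l _ ->]|].
  exact: sign_row_hypercube.
rewrite mem_cat !mem_nseq => /orP[/andP[_ /eqP ->]|/andP[_ /eqP ->]].
  exact: sign_row_hypercube.
by move=> j; rewrite !mxE ffunE /sg mul1r; left.
Qed.

Lemma rows_data_sum X b :
  data_sum (rows X (predC1 b)) = (Num.sqrt p%:R)^-1 *: \row_j colsum X b j.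
Proof.
rewrite /data_sum /rows (perm_big _ (perm_eq_seq_mset _))/= big_cat/= big_cat/=.
rewrite !big_nseq !iter_addr !addr0 mulNrn addrN addr0.
rewrite big_map big_filter big_enum_cond/=.
apply/rowP => j; rewrite summxE !mxE mulrC mulr_suml.
by apply: eq_bigr => l _; rewrite mxE.
Qed.

Lemma rows_upd X a y : rows (upd X a y) (predC1 a) = rows X (predC1 a).
Proof.
rewrite /rows; congr (seq_mset (_ ++ _)); apply/eq_in_map => l.
by rewrite mem_filter => /andP[/= /negbTE la _]; rewrite ffunE la.
Qed.

Lemma rows_insert X a b : a != b ->
  rows X (predC1 b) = sign_row (X a) +` rows X [pred l | (l != a) && (l != b)].
Proof.
move=> ab; apply/msetP => d; rewrite mset1DE !mset_seqE !(count_cat _ _ padding).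
rewrite addnA; congr addn.
rewrite -!sum1_count !big_map 2!(big_mkcond (fun l => pred1 d _))/=.
rewrite !big_filter !big_enum_cond/= (bigD1 a)//=.
congr addn; first by rewrite eq_sym; case: eqP.
by apply: eq_bigl => l; rewrite andbC.
Qed.

Lemma rows_neighbors X a b : a != b -> X a != X b ->
  (0 < p)%N -> neighbors (rows X (predC1 b)) (rows X (predC1 a)).
Proof.
move=> ab Xab p0; exists (rows X [pred l | (l != a) && (l != b)]).
exists (sign_row (X a)), (sign_row (X b)).
split.
- apply: contraNneq Xab => /rowP e; apply/eqP/ffunP => j.
  have := e j; rewrite !mxE => /mulIf.
  rewrite invr_eq0 sqrtr_eq0 -ltNge ltr0n => /(_ p0).
  by rewrite /sg; case: (X a j); case: (X b j) => //; lra.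
- exact: rows_insert.
- rewrite (@rows_insert X b a) 1?eq_sym//; congr (_ +` _).
  rewrite /rows; congr (seq_mset (map _ _ ++ _)); apply: eq_filter => l /=.
  by rewrite andbC.
Qed.

(** Neighbors must differ, so equal rows [X a = X b] are treated apart: the two inputs then coincide
    and the bound follows from [0 <= eps]. The absolute value keeps the additive term
    nonnegative. *)
Lemma rows_diff_private (A : algorithm R p) (eps delta : R) X a b :
  (0 < p)%N -> 0 <= eps -> a != b -> diff_private (m + 2 * r) eps delta A ->
  forall S, measurable S ->
  (A (rows X (predC1 b)) S <= (expR eps)%:E * A (rows X (predC1 a)) S + `|delta|%:E)%E.
Proof.
move=> p0 e0 ab dp S mS.
have [Xab|Xab] := eqVneq (X a) (X b).
  have -> : rows X (predC1 b) = rows X (predC1 a).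
    rewrite (rows_insert X ab) (@rows_insert X b a) 1?eq_sym// Xab; congr (_ +` _).
    rewrite /rows; congr (seq_mset (map _ _ ++ _)); apply: eq_filter => l /=.
    by rewrite andbC.
  rewrite -[leLHS]adde0 leeD// ?lee_fin//.
  rewrite -[leLHS]mul1e lee_wpmul2r// lee_fin.
  by rewrite -expR0 ler_expR.
apply: le_trans (dp _ _ (rows_dataset X b) (rows_dataset X a) _ S mS) _.
  exact: rows_neighbors.
by rewrite leeD2l// lee_fin ler_norm.
Qed.

End Datasets.

(** * Inner products and scores on the unit ball *)

Section Ball.
Variables (R : realType) (p : nat).
Implicit Types (v theta : 'rV[R]_p).
Local Notation ball := (@unit_ball R p : set (borel_rV R p)).

Lemma dotvC v theta : dotv v theta = dotv theta v.
Proof. by apply: eq_bigr => j _; rewrite mulrC. Qed.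

(** Cauchy-Schwarz, by expanding the nonnegative sum of squares of [B *: theta - s *: v] for the
    signs [s = 1] and [s = -1]; for [B = 0] the vector [v] vanishes. *)
Lemma dotv_unit_ball theta v (B : R) : unit_ball theta -> 0 <= B ->
  dotv v v <= B ^+ 2 -> `|dotv theta v| <= B.
Proof.
move=> th1 B0 vB.
have th2 : dotv theta theta <= 1 by rewrite -norm2_sqr expr_le1// sqrtr_ge0.
move: B0; rewrite le_eqVlt => /predU1P[B0|B0].
  have /norm2_eq0 -> : norm2 v = 0.
    apply/eqP; rewrite -sqrf_eq0 norm2_sqr eq_le dotv_ge0 andbT.
    by rewrite (le_trans vB)// -B0 expr0n.
  by rewrite /dotv big1 ?normr0 -?B0// => j _; rewrite mxE mulr0.
have h (s : R) : s ^+ 2 = 1 -> s * dotv theta v <= B.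
  move=> s1; rewrite -(ler_pM2l B0).
  have : 0 <= \sum_j (B * theta 0 j - s * v 0 j) ^+ 2.
    by apply: sumr_ge0 => j _; exact: sqr_ge0.
  have -> : \sum_j (B * theta 0 j - s * v 0 j) ^+ 2 =
      B ^+ 2 * dotv theta theta - 2 * (B * (s * dotv theta v)) + s ^+ 2 * dotv v v.
    rewrite /dotv !mulr_sumr -sumrB -big_split/=.
    by apply: eq_bigr => j _; ring.
  rewrite s1 mul1r.
  have : B ^+ 2 * dotv theta theta <= B ^+ 2 by rewrite ler_piMr ?sqr_ge0.
  rewrite -expr2; lra.
rewrite ler_norml; have := h 1; have := h (-1).
rewrite sqrrN expr1n => /(_ erefl) h1 /(_ erefl) h2; lra.
Qed.

Lemma dotv_le_norm2 theta v : unit_ball theta -> `|dotv theta v| <= norm2 v.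
Proof. by move=> th1; apply: dotv_unit_ball; rewrite ?norm2_sqr ?sqrtr_ge0. Qed.

Lemma measurable_dotv v : measurable_fun setT (fun theta : borel_rV R p => dotv theta v).
Proof.
apply: (measurability _ (RGenOpens.measurableE R)) => //.
move=> /= _ [_ [a [b ->]] <-]; rewrite setTI.
apply: sub_sigma_algebra; apply: open_comp.
  move=> theta _; apply: (@continuous_dotv _ _ id (cst v)) => y.
    exact: cvg_id.
  exact: cst_continuous.
exact: interval_open.
Qed.

Lemma bm_dotv v : bounded_measurable ball (fun theta => dotv theta v).
Proof.
split; first by apply: measurable_funTS; exact: measurable_dotv.
by exists (norm2 v) => theta; exact: dotv_le_norm2.
Qed.

Lemma scoreE m (X : {ffun 'I_m.+1 -> {ffun 'I_p -> bool}}) a theta :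
  score X a theta = dotv theta (\row_j (sg R (X a j) - cmean R X a j)).
Proof. by apply: eq_bigr => j _; rewrite mxE. Qed.

Lemma bm_score m (X : {ffun 'I_m.+1 -> {ffun 'I_p -> bool}}) a :
  bounded_measurable ball (score X a).
Proof.
rewrite (_ : score X a = fun theta => dotv theta (\row_j (sg R (X a j) - cmean R X a j))).
  exact: bm_dotv.
by apply/funext => theta; exact: scoreE.
Qed.

Lemma score_bound m (X : {ffun 'I_m.+1 -> {ffun 'I_p -> bool}}) a theta :
  unit_ball theta -> `|score X a theta| <= 2 * Num.sqrt p%:R.
Proof.
move=> th1; rewrite scoreE; apply: dotv_unit_ball => //.
rewrite exprMn sqr_sqrtr ?ler0n// mulr_natr -[X in _ *+ X]card_ord -sumr_const.
apply: ler_sum => j _; rewrite mxE -expr2 -real_normK ?num_real// ler_pXn2r// ?nnegrE//.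
exact: score_coef_norm.
Qed.

End Ball.

(** * Expectations over the prior and the algorithm *)

Section Fingerprinting.
Variables (R : realType) (m p r : nat) (A : algorithm R p).
Hypothesis p0 : (0 < p)%N.
Hypothesis ballA : output_in_ball (m + 2 * r) A.
Local Notation row := {ffun 'I_p -> bool}.
Local Notation conf := {ffun 'I_m.+1 -> row}.
Local Notation ball := (@unit_ball R p : set (borel_rV R p)).
Implicit Types (X : conf) (a b : 'I_m.+1) (j : 'I_p) (y : row).

Let mball : measurable ball := @measurable_unit_ball R p.

Definition law X b : probability (borel_rV R p) R := A (rows R r X (predC1 b)).

(* Unnormalised: to be compared with [\sum_X weight R X]. *)
Definition expect b (F : conf -> 'rV[R]_p -> R) : R :=
  \sum_X weight R X * \int[law X b]_(theta in ball) F X theta.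

Local Notation W := (\sum_(X : conf) weight R X).

Let law_ball X b : law X b ball = 1%E.
Proof. exact/ballA/rows_dataset. Qed.

Let w0 X : 0 <= weight R X. Proof. exact/ltW/weight_gt0. Qed.

Lemma expectD b F G : (forall X, bounded_measurable ball (F X)) ->
  (forall X, bounded_measurable ball (G X)) ->
  expect b (fun X theta => F X theta + G X theta) = expect b F + expect b G.
Proof.
move=> bF bG; rewrite /expect -big_split/=; apply: eq_bigr => X _.
by rewrite RintD// mulrDr.
Qed.

Lemma expectZ b c F : (forall X, bounded_measurable ball (F X)) ->
  expect b (fun X theta => c * F X theta) = c * expect b F.
Proof.
move=> bF; rewrite /expect mulr_sumr; apply: eq_bigr => X _.
by rewrite RintZ// mulrCA.
Qed.

Lemma expect_sum b (I : finType) (Q : pred I) (F : I -> conf -> 'rV[R]_p -> R) :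
  (forall i X, bounded_measurable ball (F i X)) ->
  expect b (fun X theta => \sum_(i | Q i) F i X theta) = \sum_(i | Q i) expect b (F i).
Proof.
move=> bF; rewrite /expect exchange_big/=; apply: eq_bigr => X _.
by rewrite Rint_sum// ?mulr_sumr.
Qed.

Lemma le_expect b F G : (forall X, bounded_measurable ball (F X)) ->
  (forall X, bounded_measurable ball (G X)) ->
  (forall X theta, unit_ball theta -> F X theta <= G X theta) ->
  expect b F <= expect b G.
Proof.
move=> bF bG FG; apply: ler_sum => X _; rewrite ler_wpM2l//.
by apply: le_Rint => // theta; exact: FG.
Qed.

Lemma expect_cst b c : expect b (fun _ _ => c) = c * W.
Proof.
rewrite /expect mulr_sumr; apply: eq_bigr => X _.
by rewrite Rint_cst// mulrC.
Qed.

(* The output law on the data set without row [a] does not depend on row [a], so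
   that row can be resampled first, with the output held fixed. *)
Lemma expect_resample a F : (forall X, bounded_measurable ball (F X)) ->
  #|{: row}|%:R * expect a F =
  \sum_X \int[law X a]_(theta in ball)
    (\sum_y weight R (upd X a y) * F (upd X a y) theta).
Proof.
move=> bF; rewrite -(sum_resample _ a); apply: eq_bigr => X _.
rewrite Rint_sum//; last by move=> y _; exact: bmZ.
by apply: eq_bigr => y _; rewrite /law rows_upd RintZ.
Qed.

Let row_gt0 : 0 < #|{: row}|%:R :> R.
Proof. by rewrite ltr0n; apply/card_gt0P; exists [ffun=> true]. Qed.

Lemma expect_score a : expect a (fun X => score X a) = 0.
Proof.
apply/eqP; rewrite -(mulrI_eq0 _ (lregP (lt0r_neq0 row_gt0))); apply/eqP.
rewrite expect_resample => [|X]; last exact: bm_score.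
rewrite big1// => X _; rewrite -[RHS](Rint_cst mball (law_ball X a)).
by apply: eq_Rintegral => theta _; exact: sum_weight_score.
Qed.

Lemma expect_exp_score a lam :
  expect a (fun X theta => expR (lam * score X a theta)) <= expR (8 * lam ^+ 2) * W.
Proof.
have be X : bounded_measurable ball (fun theta => expR (lam * score X a theta)).
  by apply: bm_exp => //; apply: bmZ; exact: bm_score.
rewrite -(ler_pM2l row_gt0) expect_resample// mulrCA -(sum_resample _ a) mulr_sumr.
apply: ler_sum => X _; rewrite -[leRHS](Rint_cst mball (law_ball X a)).
apply: le_Rint => //.
- by apply: bm_sum => y _; exact: bmZ.
- exact: bm_cst.
- by move=> theta; exact: sum_weight_exp_score.
Qed.

(** * Upper bounds on the scores of input rows *)

Section Privacy.
Variables (eps delta : R).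
Hypothesis dpA : diff_private (m + 2 * r) eps delta A.
Hypothesis eps0 : 0 <= eps.

Lemma le_expect_dp a b (F : conf -> 'rV[R]_p -> R) B : a != b ->
  (forall X, measurable_fun ball (F X)) ->
  (forall X theta, unit_ball theta -> 0 <= F X theta <= B) -> 0 <= B ->
  expect b F <= expR eps * expect a F + `|delta| * B * W.
Proof.
move=> ab mF F0B B0; rewrite /expect !mulr_sumr -big_split/=; apply: ler_sum => X _.
rewrite mulrCA [X in _ + X]mulrC -mulrDr ler_wpM2l//.
apply: le_integral_dp => //; last exact: F0B.
exact: rows_diff_private dpA.
Qed.

Let bm_posscore X a (s c : R) :
  bounded_measurable ball (fun theta => Num.max (s * score X a theta + c) 0).
Proof.
apply: bm_max; last exact: bm_cst.
by apply: bmD; [apply: bmZ; exact: bm_score|exact: bm_cst].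
Qed.

(** Privacy bounds nonnegative functions only, so it is applied to the positive part from [a] to [b]
    and to the negative part from [b] to [a]. When row [a] is omitted both parts have the same mean
    [P], at most [expR 8 * W]; each direction costs [(expR eps - 1) * P] and one [delta] term. *)
Lemma expect_score_le_small a b : a != b -> eps <= 1 ->
  expect b (fun X => score X a) <=
  (6 * expR 8 * eps + 4 * (`|delta| * Num.sqrt p%:R)) * W.
Proof.
move=> ab eps1; pose B : R := 2 * Num.sqrt p%:R.
have B0 : 0 <= B by rewrite mulr_ge0 ?sqrtr_ge0.
pose U (s : R) X theta := Num.max (s * score X a theta + 0) 0.
have bU s X : bounded_measurable ball (U s X) by exact: bm_posscore.
have UB s : s ^+ 2 = 1 -> forall X theta, unit_ball theta -> 0 <= U s X theta <= B.
  move=> s1 X theta th1; rewrite le_max lexx orbT ge_max B0 andbT addr0/=.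
  apply: (le_trans (ler_norm _)); rewrite normrM (_ : `|s| = 1) ?mul1r; last first.
    by apply/eqP; rewrite -(@eqrXn2 _ 2)// expr1n real_normK ?num_real// s1.
  exact: score_bound.
have UE c : expect c (fun X => score X a) = expect c (U 1) - expect c (U (-1)).
  rewrite -[- expect c _]mulN1r -expectZ// -expectD//; last by move=> X; exact: bmZ.
  apply: eq_bigr => X _; congr (_ * _); apply: eq_Rintegral => theta _.
  rewrite /U mul1r !addr0 !mulN1r; case: (leP (score X a theta) 0) => h.
    by rewrite max_l ?oppr_ge0// opprK add0r.
  by rewrite max_r ?subr0// oppr_le0 ltW.
have Uexp s : s ^+ 2 = 1 -> expect a (U s) <= expR 8 * W.
  move=> s1; have := expect_exp_score a s; rewrite s1 mulr1; apply: le_trans.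
  apply: le_expect => // [X|X theta _].
    by apply: bm_exp => //; apply: bmZ; exact: bm_score.
  rewrite ge_max expR_ge0 andbT addr0.
  by apply: le_trans (expR_ge1Dx _); rewrite ler_wpDl.
have s1 : (1 : R) ^+ 2 = 1 by rewrite expr1n.
have sN1 : (-1 : R) ^+ 2 = 1 by rewrite sqrrN expr1n.
have hP := le_expect_dp ab (fun X => (bU 1 X).1) (UB _ s1) B0.
have ba : b != a by rewrite eq_sym.
have hN := le_expect_dp ba (fun X => (bU (-1) X).1) (UB _ sN1) B0.
have := UE a; rewrite expect_score => /esym/eqP; rewrite subr_eq0 => /eqP PN.
rewrite UE.
have := Uexp _ s1; have := Uexp _ sN1; rewrite PN in hP *.
set P := expect a _ in hP hN *; set N := expect b (U (-1)) in hN *.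
set Q := expect b (U 1) in hP *.
have W0 : 0 < W by exact: total_weight_gt0.
have dB0 : 0 <= `|delta| * B * W by rewrite !mulr_ge0// ltW.
have P0 : 0 <= P.
  apply: sumr_ge0 => X _; rewrite mulr_ge0//; apply: Rintegral_ge0 => theta th1.
  by case/andP: (UB _ sN1 X theta th1).
have N0 : 0 <= N.
  apply: sumr_ge0 => X _; rewrite mulr_ge0//; apply: Rintegral_ge0 => theta th1.
  by case/andP: (UB _ sN1 X theta th1).
move=> _ PW.
have e1 : 1 <= expR eps by rewrite -expR0 ler_expR.
have hE : expR eps - 1 <= 3 * eps.
  have : eps ^+ 2 <= eps by rewrite expr2 ler_piMr.
  by have := expR_le_quadratic eps1; lra.
(* If [P <= N] the left side is nonpositive; otherwise [N] on the right may be enlarged to [P]. *)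
have hN' : P - N <= (expR eps - 1) * P + `|delta| * B * W.
  have [PN'|NP] := leP P N.
    by rewrite (@le_trans _ _ 0)// ?subr_le0// addr_ge0// mulr_ge0// subr_ge0.
  have : (expR eps - 1) * N <= (expR eps - 1) * P.
    by apply: ler_wpM2l; [rewrite subr_ge0|exact: ltW].
  lra.
have hF : (expR eps - 1) * P <= 3 * eps * (expR 8 * W).
  by rewrite ler_pM// subr_ge0.
rewrite (_ : (_ + _) * W = 2 * (3 * eps * (expR 8 * W)) + 2 * (`|delta| * B * W)); last first.
  by rewrite /B; ring.
lra.
Qed.

(** The score is at most 9 sqrt(eps) plus its excess over that level. By the exponential moment at
    [lam] = sqrt(eps), the excess has mean at most exp(8 eps - 9 eps) when row [a] is omitted, which
    cancels the privacy factor exp(eps). *)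
Lemma expect_score_le_large a b : a != b -> 1 <= eps ->
  expect b (fun X => score X a) <=
  (10 * Num.sqrt eps + 2 * (`|delta| * Num.sqrt p%:R)) * W.
Proof.
move=> ab eps1; pose B : R := 2 * Num.sqrt p%:R.
have B0 : 0 <= B by rewrite mulr_ge0 ?sqrtr_ge0.
set s := Num.sqrt eps.
have s1 : 1 <= s by rewrite -sqrtr1 ler_wsqrtr.
have ss : s ^+ 2 = eps by rewrite sqr_sqrtr.
pose V X theta := Num.max (1 * score X a theta + - (9 * s)) 0.
have bV X : bounded_measurable ball (V X) by exact: bm_posscore.
have VB X theta : unit_ball theta -> 0 <= V X theta <= B.
  move=> th1; rewrite le_max lexx orbT ge_max B0 andbT/= mul1r.
  have := le_trans (ler_norm _) (score_bound X a th1); rewrite -/B; lra.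
have hV := le_expect_dp ab (fun X => (bV X).1) VB B0.
have W0 : 0 < W by exact: total_weight_gt0.
have h1 : expect b (fun X => score X a) <= 9 * s * W + expect b V.
  rewrite -(expect_cst b) -expectD//; last by move=> X; exact: bm_cst.
  apply: le_expect => [X|X|X theta _]; first exact: bm_score.
    by apply: bmD => //; exact: bm_cst.
  by rewrite /V mul1r addr_maxr addrCA subrr addr0 le_max lexx.
have h2 : expect a V <= expR (- (9 * eps)) * (expR (8 * eps) * W).
  rewrite -{2}ss; apply: le_trans (ler_wpM2l (expR_ge0 _) (expect_exp_score a s)).
  have be X : bounded_measurable ball (fun theta => expR (s * score X a theta)).
    by apply: bm_exp => //; apply: bmZ; exact: bm_score.
  rewrite -expectZ//; apply: le_expect => // [X|X theta _]; first exact: bmZ.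
  rewrite -expRD -ss (_ : _ + _ = s * (score X a theta - 9 * s)); last by ring.
  rewrite /V mul1r ge_max expR_ge0 andbT.
  set u := score X a theta - 9 * s.
  have [u0|u0] := leP u 0; first by rewrite (le_trans u0)// expR_ge0.
  (* Since [1 <= s] and [0 < u], one has [u <= s * u <= expR (s * u)]. *)
  by apply: le_trans (expR_ge1Dx _); rewrite ler_wpDl// ler_peMl// ltW.
have h3 : expR eps * expect a V <= W.
  apply: (le_trans (ler_wpM2l (expR_ge0 _) h2)).
  by rewrite !mulrA -!expRD (_ : _ + _ + _ = 0) ?expR0 ?mul1r//; ring.
have h4 : W <= s * W by rewrite ler_peMl// ltW.
rewrite (_ : (_ + _) * W = 9 * s * W + s * W + `|delta| * B * W); last first.
  by rewrite /B; ring.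
lra.
Qed.

End Privacy.

(** * Lower bound on the total score of the input rows *)

Lemma score_sum X b theta :
  \sum_(a | a != b) score X a theta =
  (2 * m%:R + 6) / m.+2%:R ^+ 2 * dotv theta (\row_j colsum R X b j)
  + - (m%:R / m.+2%:R) * score X b theta.
Proof.
rewrite /score exchange_big/= /dotv !mulr_sumr -big_split/=; apply: eq_bigr => j _.
rewrite -mulr_sumr mxE sumrB -/(colsum R X b j).
set S := colsum R X b j.
have -> : cmean R X b j = S / m.+2%:R by [].
have -> : \sum_(a | a != b) cmean R X a j =
    (m%:R * (S + sg R (X b j)) - S) / m.+2%:R.
  rewrite /cmean -mulr_suml; congr (_ / _).
  rewrite (eq_bigr (fun a => S + sg R (X b j) - sg R (X a j))).
    by rewrite sumrB sumr_const card_others mulr_natl.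
  move=> a ab; have total c : \sum_l sg R (X l j) = sg R (X c j) + colsum R X c j.
    by rewrite (bigD1 c).
  by have := total a; rewrite (total b) -/S /colsum; lra.
(* Column [j] contributes (3 S - m x) / (m + 2), with x the sign in the omitted row. It is regrouped
   to split off the score of that row, whose expectation is zero. *)
field; apply: lt0r_neq0; have := ler0n R m; lra.
Qed.

(** Among the m^2 pairs of rows in the expanded square, the diagonal ones contribute [W] and the
    others [W / 3]. *)
Lemma colsum_moment b j : m%:R ^+ 2 / 3 * W <=
  \sum_X weight R X * colsum R X b j ^+ 2.
Proof.
have W0 : 0 < W by exact: total_weight_gt0.
have -> : \sum_X weight R X * colsum R X b j ^+ 2 =
    \sum_(l | l != b) \sum_(k | k != b) \sum_X weight R X * (sg R (X l j) * sg R (X k j)).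
  under [RHS]eq_bigr do rewrite exchange_big.
  rewrite exchange_big/=; apply: eq_bigr => X _.
  rewrite expr2 /colsum mulr_suml mulr_sumr; apply: eq_bigr => l _.
  by rewrite -mulr_sumr -mulr_sumr.
have h (l k : 'I_m.+1) : 3^-1 * W <= \sum_X weight R X * (sg R (X l j) * sg R (X k j)).
  have [->|lk] := eqVneq l k; last by rewrite sum_weight_sg_sg.
  rewrite (_ : \sum_X _ = W); first by lra.
  by apply: eq_bigr => X _; rewrite sg_sqr mulr1.
apply: (@le_trans _ _ (\sum_(l | l != b) \sum_(k | k != b) 3^-1 * W)).
  rewrite !sumr_const !card_others -mulrnA -[leRHS]mulr_natr natrM.
  by rewrite [leRHS](_ : _ = m%:R ^+ 2 / 3 * W) //; ring.
by apply: ler_sum => l _; apply: ler_sum => k _; exact: h.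
Qed.

Let s X b : 'rV[R]_p := data_sum (rows R r X (predC1 b)).

Let sqrtp_gt0 : 0 < Num.sqrt p%:R :> R. Proof. by rewrite sqrtr_gt0 ltr0n. Qed.

(** The data sum has norm at most m, so its norm is at least its square over m; this reduces the
    first moment to the second. *)
Lemma data_sum_moment b : m%:R / 3 * W <= \sum_X weight R X * norm2 (s X b).
Proof.
have [m0|m0] := posnP m.
  rewrite (_ : m%:R = 0) ?m0// mul0r mul0r; apply: sumr_ge0 => X _.
  by rewrite mulr_ge0// sqrtr_ge0.
have mR : 0 < m%:R :> R by rewrite ltr0n.
have sqE X : dotv (s X b) (s X b) = p%:R^-1 * \sum_j colsum R X b j ^+ 2.
  rewrite /s rows_data_sum /dotv mulr_sumr; apply: eq_bigr => j _.
  by rewrite !mxE mulrACA -invfM -expr2 sqr_sqrtr// -expr2.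
have sm X : norm2 (s X b) <= m%:R.
  rewrite -(@ler_pXn2r _ 2)// ?nnegrE ?sqrtr_ge0// norm2_sqr sqE.
  rewrite ler_pdivrMl ?ltr0n// mulr_natl -[X in _ *+ X]card_ord -sumr_const.
  apply: ler_sum => j _; rewrite -[colsum _ _ _ _ ^+ 2]real_normK ?num_real//.
  rewrite ler_pXn2r ?nnegrE//; apply: (le_trans (ler_norm_sum _ _ _)).
  under eq_bigr do rewrite sg_norm.
  by rewrite sumr_const card_others.
apply: (@le_trans _ _ (\sum_X weight R X * (m%:R^-1 * dotv (s X b) (s X b)))); last first.
  apply: ler_sum => X _; rewrite ler_wpM2l// ler_pdivrMl// -norm2_sqr expr2.
  by rewrite ler_wpM2r ?sqrtr_ge0.
rewrite [leRHS](eq_bigr (fun X => m%:R^-1 * (p%:R^-1 *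
    \sum_j weight R X * colsum R X b j ^+ 2))); last first.
  by move=> X _; rewrite sqE -mulr_sumr; ring.
rewrite -!mulr_sumr exchange_big/=.
apply: (@le_trans _ _ (m%:R^-1 * (p%:R^-1 * \sum_(j < p) (m%:R ^+ 2 / 3 * W)))).
  rewrite sumr_const card_ord -[(_ * _) *+ p]mulr_natl mulKf ?pnatr_eq0 -?lt0n//.
  by rewrite [leRHS](_ : _ = m%:R / 3 * W)//; field; rewrite gt_eqF.
rewrite !ler_wpM2l ?invr_ge0//; apply: ler_sum => j _; exact: colsum_moment.
Qed.

(** With [N] the norm of the data sum, the inner product is at least [N - t] off the event of large
    excess loss and at least [- N] on it. That event has probability below 1/3, so the mean is at
    least [N - t - 2 * N / 3]. *)
Lemma expect_dotv_ge b t : 0 <= t ->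
  (forall X, (law X b [set theta | (t <= loss theta (rows R r X (predC1 b))
      - loss (theta_star (rows R r X (predC1 b))) (rows R r X (predC1 b)))%R]
    < (3^-1)%:E)%E) ->
  (m%:R / 9 - t) * W <= expect b (fun X theta => dotv theta (s X b)).
Proof.
move=> t0 fail.
have h X : 3^-1 * norm2 (s X b) - t <= \int[law X b]_(theta in ball) dotv theta (s X b).
  pose bad := [set theta : borel_rV R p |
    t <= loss theta (rows R r X (predC1 b))
      - loss (theta_star (rows R r X (predC1 b))) (rows R r X (predC1 b))].
  have mbad : measurable bad := @measurable_excess R p _ t.
  set N := norm2 (s X b); have N0 : 0 <= N by exact: sqrtr_ge0.
  have small : \int[law X b]_(theta in ball) \1_bad theta <= 3^-1.
    rewrite Rint_indic// -lee_fin fineK ?fin_num_measure//; last exact: measurableI.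
    apply/ltW/(le_lt_trans _ (fail X)); apply: le_measure; rewrite ?inE//.
    exact: measurableI.
  have bi : bounded_measurable ball (fun theta => - (2 * N) * \1_bad theta).
    by apply: bmZ; exact: bm_indic.
  have : \int[law X b]_(theta in ball) (N - t + - (2 * N) * \1_bad theta) <=
      \int[law X b]_(theta in ball) dotv theta (s X b).
    apply: le_Rint => //; [by apply: bmD => //; exact: bm_cst|exact: bm_dotv|].
    move=> theta th1; have := dotv_le_norm2 (s X b) th1; rewrite -/N ler_norml.
    move=> /andP[lb _]; rewrite indicE.
    case: (boolP (theta \in bad)) => [_|/negP thb]; first by rewrite mulr1; lra.
    rewrite mulr0 addr0; apply/ltW; rewrite ltNge; apply/negP => hle; apply: thb.
    rewrite inE /bad /= loss_theta_star /loss -/(s X b) -/N; lra.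
  rewrite RintD//; last exact: bm_cst.
  rewrite Rint_cst// RintZ//; last exact: bm_indic.
  have : 2 * N * \int[law X b]_(theta in ball) \1_bad theta <= 2 * N * 3^-1.
    by rewrite ler_wpM2l// mulr_ge0.
  lra.
apply: (@le_trans _ _ (\sum_X weight R X * (3^-1 * norm2 (s X b) - t))).
  rewrite [leRHS](eq_bigr (fun X =>
      3^-1 * (weight R X * norm2 (s X b)) - weight R X * t)); last first.
    by move=> X _; ring.
  rewrite sumrB -mulr_sumr -mulr_suml.
  by have := data_sum_moment b; lra.
by apply: ler_sum => X _; rewrite ler_wpM2l.
Qed.

(** The total score is estimated in two ways: each of the m input rows contributes at most [f * W],
    while the inner product with the data sum is at least [m / 18 * W] in mean. *)
Lemma fingerprinting b t f : 0 <= t <= m%:R / 18 -> (0 < m)%N ->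
  (forall a, a != b -> expect b (fun X => score X a) <= f * W) ->
  (forall X, (law X b [set theta | (t <= loss theta (rows R r X (predC1 b))
      - loss (theta_star (rows R r X (predC1 b))) (rows R r X (predC1 b)))%R]
    < (3^-1)%:E)%E) ->
  Num.sqrt p%:R <= 27 * (m%:R * f).
Proof.
move=> /andP[t0 tm] m0 scoref fail.
have W0 : 0 < W by exact: total_weight_gt0.
have mR : 1 <= m%:R :> R by rewrite ler1n.
have lower := expect_dotv_ge t0 fail.
set E := expect b _ in lower.
set c : R := (2 * m%:R + 6) / m.+2%:R ^+ 2 * Num.sqrt p%:R.
have sumE : c * E = \sum_(a | a != b) expect b (fun X => score X a).
  rewrite -expect_sum; last by move=> a X; exact: bm_score.
  rewrite /E -expectZ; last by move=> X; exact: bm_dotv.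
  transitivity (expect b (fun X theta => c * dotv theta (s X b)) +
      expect b (fun X theta => - (m%:R / m.+2%:R) * score X b theta)).
    by rewrite [X in _ + X]expectZ ?expect_score ?mulr0 ?addr0// => X; exact: bm_score.
  rewrite -expectD; last 2 first.
  - by move=> X; apply: bmZ; exact: bm_dotv.
  - by move=> X; apply: bmZ; exact: bm_score.
  apply: eq_bigr => X _; congr (_ * _); apply: eq_Rintegral => theta _.
  rewrite score_sum -[c * _]mulrA; congr (_ * _ + _).
  by rewrite /s rows_data_sum dotvC dotvZl dotvC mulVKf// gt_eqF.
have upper : c * E <= m%:R * f * W.
  have -> : m%:R * f * W = \sum_(a | a != b) f * W.
    by rewrite sumr_const card_others -mulrA mulr_natl.
  by rewrite sumE; apply: ler_sum => a; exact: scoref.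
have m2 : m.+2%:R = m%:R + 2 :> R by rewrite -addn2 natrD.
have c0 : 2 / (m%:R + 2) * Num.sqrt p%:R <= c.
  rewrite /c m2 ler_wpM2r ?sqrtr_ge0// ler_pdivrMr; last lra.
  rewrite mulrAC ler_pdivlMr; [nra|by rewrite exprn_gt0//; lra].
(* Since m + 2 <= 3 m; the product of 2 / (3 m) and m / 18 is 1/27. *)
have c1 : 2 / (3 * m%:R) * Num.sqrt p%:R <= c.
  apply: le_trans c0; rewrite ler_wpM2r ?sqrtr_ge0// ler_wpM2l//.
  by rewrite lef_pV2 ?posrE; lra.
have EW : m%:R / 18 * W <= E.
  by apply: le_trans lower; rewrite ler_pM2r//; lra.
have : 2 / (3 * m%:R) * Num.sqrt p%:R * (m%:R / 18 * W) <= m%:R * f * W.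
  apply: le_trans upper; apply: ler_pM => //.
  by rewrite mulr_ge0// ltW.
rewrite [X in X <= _](_ : _ = Num.sqrt p%:R / 27 * W); last first.
  by field; apply: lt0r_neq0; lra.
by rewrite ler_pM2r//; lra.
Qed.

End Fingerprinting.

(** Padding adds rows in pairs, so m must have the parity of n. *)
Lemma exists_same_parity (n k : nat) : (k + 2 <= n)%N ->
  exists m r, [/\ (k < m)%N, (m <= k + 2)%N & (m + 2 * r = n)%N].
Proof.
move=> kn; have := odd_double_half (n - k); case: odd => /= e.
  by exists k.+1, (n - k)./2; rewrite -mul2n in e; split; lia.
by exists k.+2, (n - k)./2.-1; rewrite -mul2n in e; split; lia.
Qed.

(** * Numerical constants *)

Section Calibration.
Variables (R : realType) (c0 p eps mR d : R).
Hypotheses (p1 : 1 <= p) (eps0 : 0 < eps) (c00 : 0 < c0).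
Hypothesis epsp : eps <= c0 ^+ 2 * p.
Hypothesis c0K : c0 * (1000 * expR 8) = 1.
Hypotheses (mR0 : 0 <= mR) (mle : mR <= c0 * (Num.sqrt p / eps) + 2).
Hypothesis md : mR * d <= 1000^-1.

Let K1 : 1 <= expR 8 :> R. Proof. by rewrite -expR0 ler_expR. Qed.

Let sp1 : 1 <= Num.sqrt p. Proof. by rewrite -sqrtr1 ler_wsqrtr. Qed.

Let seps0 : 0 < Num.sqrt eps. Proof. by rewrite sqrtr_gt0. Qed.

(** This absorbs the up to two extra rows that come from rounding m. *)
Let seps : Num.sqrt eps <= c0 * Num.sqrt p.
Proof.
have -> : c0 = Num.sqrt (c0 ^+ 2) by rewrite sqrtr_sqr gtr0_norm.
by rewrite -sqrtrM ?sqr_ge0// ler_wsqrtr.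
Qed.

Let sepsE : Num.sqrt eps ^+ 2 = eps. Proof. by rewrite sqr_sqrtr// ltW. Qed.

Lemma calibration_small : eps <= 1 ->
  27 * (mR * (6 * expR 8 * eps + 4 * (d * Num.sqrt p))) < Num.sqrt p.
Proof.
move=> eps1.
have es : eps <= Num.sqrt eps.
  have : Num.sqrt eps <= 1 by rewrite -sqrtr1 ler_wsqrtr.
  by move=> h; rewrite -{1}sepsE expr2 ler_piMl// ltW.
have me : mR * eps <= 3 * (c0 * Num.sqrt p).
  apply: (@le_trans _ _ ((c0 * (Num.sqrt p / eps) + 2) * eps)).
    by rewrite ler_wpM2r// ltW.
  by rewrite mulrDl -mulrA divfK ?gt_eqF//; have := seps; lra.
have h1 : expR 8 * (mR * eps) <= 3 / 1000 * Num.sqrt p.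
  apply: (@le_trans _ _ (expR 8 * (3 * (c0 * Num.sqrt p)))).
    by rewrite ler_wpM2l// expR_ge0.
  rewrite [leLHS](_ : _ = (c0 * (1000 * expR 8)) * (3 / 1000 * Num.sqrt p)); last by field.
  by rewrite c0K mul1r.
have h2 : mR * d * Num.sqrt p <= 1000^-1 * Num.sqrt p by rewrite ler_wpM2r// sqrtr_ge0.
(* The two terms are at most 0.486 and 0.108 times sqrt(p). *)
rewrite [ltLHS](_ : _ =
  162 * (expR 8 * (mR * eps)) + 108 * (mR * d * Num.sqrt p)); last by ring.
by have := sp1; lra.
Qed.

Lemma calibration_large : 1 <= eps ->
  27 * (mR * (10 * Num.sqrt eps + 2 * (d * Num.sqrt p))) < Num.sqrt p.
Proof.
move=> eps1.
have se1 : 1 <= Num.sqrt eps by rewrite -sqrtr1 ler_wsqrtr.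
have me : mR * Num.sqrt eps <= 3 * (c0 * Num.sqrt p).
  apply: (@le_trans _ _ ((c0 * (Num.sqrt p / eps) + 2) * Num.sqrt eps)).
    by rewrite ler_wpM2r// ltW.
  rewrite mulrDl.
  have : c0 * (Num.sqrt p / eps) * Num.sqrt eps <= c0 * Num.sqrt p.
    rewrite -mulrA ler_pM2l// mulrAC ler_pdivrMr//.
    by rewrite ler_wpM2l ?sqrtr_ge0// -{2}sepsE expr2 ler_peMl// ltW.
  by have := seps; lra.
have h1 : c0 * Num.sqrt p <= 1000^-1 * Num.sqrt p.
  rewrite ler_wpM2r ?sqrtr_ge0//.
  have : c0 * 1 <= c0 * expR 8 by rewrite ler_pM2l.
  by have := c0K; lra.
have h2 : mR * d * Num.sqrt p <= 1000^-1 * Num.sqrt p by rewrite ler_wpM2r// sqrtr_ge0.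
(* The two terms are at most 0.81 and 0.054 times sqrt(p). *)
rewrite [ltLHS](_ : _ = 270 * (mR * Num.sqrt eps) + 54 * (mR * d * Num.sqrt p)); last by ring.
by have := sp1; lra.
Qed.

End Calibration.

Theorem theorem5p3 (R : realType) :
  exists c kappa : R, [/\ 0 < c, 0 < kappa &
    forall delta : nat -> R,
      (fun n : nat => n%:R * delta n) @ \oo --> (0 : R) ->
    exists N : nat,
    forall (n p : nat) (eps : R),
      (N <= n)%N -> (0 < p)%N -> 0 < eps -> eps <= kappa * p%:R ->
    forall A : algorithm R p,
      diff_private n eps (delta n) A ->
      output_in_ball n A ->
    exists2 D : {mset 'rV[R]_p}, dataset n D &
      ((3^-1 : R)%:E <=
        A D [set theta | (c * Num.min n%:R (Num.sqrt p%:R / eps) <=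
                          loss theta D - loss (theta_star D) D)%R])%E].
Proof.
pose c0 : R := (1000 * expR 8)^-1.
have K1 : 1 <= expR 8 :> R by rewrite -expR0 ler_expR.
have KK : 0 < 1000 * expR 8 :> R by lra.
have c00 : 0 < c0 by rewrite invr_gt0.
have c0K : c0 * (1000 * expR 8) = 1 by apply: mulVf; exact: lt0r_neq0 KK.
have c01 : c0 <= 2^-1 by rewrite lef_pV2 ?posrE; lra.
(* The factor 1/18 matches the threshold allowed in [fingerprinting]; [c0 ^+ 2] turns the bound on
   [eps] into sqrt(eps) <= [c0] sqrt(p). *)
exists (c0 / 18), (c0 ^+ 2); split; [by rewrite divr_gt0|by rewrite exprn_gt0|].
move=> delta /cvgrPdist_lt cv.
have eta0 : 0 < 1000^-1 :> R by lra.
have [N _ hN] := cv _ eta0.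
(* From [4 <= n] and [2 * k <= n] follows [k + 2 <= n], leaving room for m. *)
exists (maxn N 4) => n p eps; rewrite geq_max => /andP[Nn n4] p0 eps0 epsp A dpA ballA.
have nd : n%:R * `|delta n| <= 1000^-1.
  by have := hN n Nn; rewrite sub0r normrN normrM normr_nat => /ltW.
apply: contrapT => none.
have fail D : dataset n D -> (A D [set theta | (c0 / 18 * Num.min n%:R (Num.sqrt p%:R / eps) <=
    loss theta D - loss (theta_star D) D)%R] < (3^-1)%:E)%E.
  by move=> dD; rewrite ltNge; apply/negP => hD; apply: none; exists D.
set M := Num.min _ _ in fail.
have M0 : 0 <= M by rewrite le_min ler0n divr_ge0 ?sqrtr_ge0// ltW.
have x0 : 0 <= c0 * M by rewrite mulr_ge0// ltW.
(* [k] is the integer part of [c0 * M], so m, being [k + 1] or [k + 2], is at least [c0 * M] and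
   exceeds it by at most 2. *)
have /andP[kx xk] := Num.Theory.truncn_itv x0.
set k := Num.truncn _ in kx xk.
have kn : (k + 2 <= n)%N.
  have : c0 * M <= 2^-1 * n%:R by rewrite ler_pM ?ge_min ?lexx// ltW.
  move=> /(le_trans kx) => h; have : (2 * k <= n)%N by rewrite -(@ler_nat R) natrM; lra.
  by move: n4; clear; lia.
have [m [r [km mk mr]]] := exists_same_parity kn.
rewrite -mr in dpA ballA fail nd.
have mn : (m <= n)%N by rewrite -mr leq_addr.
have m0 : (0 < m)%N by apply: leq_trans km.
have mM : c0 * M <= m%:R by apply: le_trans (ltW xk) _; rewrite ler_nat.
have mle : m%:R <= c0 * (Num.sqrt p%:R / eps) + 2.
  apply: (@le_trans _ _ (k + 2)%:R); first by rewrite ler_nat.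
  rewrite natrD lerD2r (le_trans kx)// ler_pM2l// /M.
  by rewrite ge_min lexx orbT.
have md : m%:R * `|delta (m + 2 * r)%N| <= 1000^-1.
  by apply: le_trans nd; rewrite ler_wpM2r// ler_nat leq_addr.
have t_le : 0 <= c0 / 18 * M <= m%:R / 18 by apply/andP; split; lra.
have key f : (forall a : 'I_m.+1, a != ord0 -> expect r A ord0 (fun X => score X a) <=
    f * \sum_(X : {ffun 'I_m.+1 -> {ffun 'I_p -> bool}}) weight R X) ->
  Num.sqrt p%:R <= 27 * (m%:R * f).
  move=> hf; apply: (fingerprinting p0 ballA t_le m0 hf) => X.
  exact: fail _ (rows_dataset _ _ X ord0).
have p1 : 1 <= p%:R :> R by rewrite ler1n.
have [eps1|eps1] := leP eps 1.
  have := key _ (fun a a0 => expect_score_le_small p0 ballA dpA (ltW eps0) a0 eps1).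
  by rewrite leNgt (calibration_small p1 eps0 c00 epsp c0K)// ltW.
have := key _ (fun a a0 => expect_score_le_large p0 ballA dpA (ltW eps0) a0 (ltW eps1)).
by rewrite leNgt (calibration_large p1 eps0 c00 epsp c0K)// ltW.
Qed.
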